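(* Let $\alpha,\gamma>-1$ and assume $(1-x)(1-y)=0$. Then $$(1-x)P_0=\tfrac12Q_1-\frac{1}{2(2+\gamma+\alpha)}P_1+\frac{1+\gamma}{2(2+\gamma+\alpha)}P_0,$$ $$\begin{aligned}(1-x)P_1={}&\frac{\gamma+\alpha+2}{2(4+\gamma+\alpha)}Q_2-\frac{\gamma+\alpha+2}{(3+\gamma+\alpha)(4+\gamma+\alpha)}P_2-\frac{1+\alpha}{4+\gamma+\alpha}Q_1\\&+\frac{4+3\alpha+\gamma(3+\gamma+\alpha)}{2(2+\gamma+\alpha)(4+\gamma+\alpha)}P_1-\frac{(1+\gamma)(1+\alpha)}{2(2+\gamma+\alpha)(3+\gamma+\alpha)}P_0,\end{aligned}$$ $$\begin{aligned}(1-x)Q_1={}&-\frac1{2(4+\gamma+\alpha)}Q_2+\frac1{(3+\gamma+\alpha)(4+\gamma+\alpha)}P_2+\frac{3+\gamma}{2(4+\gamma+\alpha)}Q_1\\&-\frac{2+\gamma}{(2+\gamma+\alpha)(4+\gamma+\alpha)}P_1+\frac{(1+\gamma)(2+\gamma)}{2(2+\gamma+\alpha)(3+\gamma+\alpha)}P_0,\end{aligned}$$ and, for $n=2,3,\dots$, $$\begin{aligned}(1-x)P_n={}&\frac{(1+\gamma+\alpha+n)(n+\gamma+\alpha+2)}{2(1+\gamma+\alpha+2n)(2+\gamma+\alpha+2n)}Q_{n+1}-\frac{(1+\gamma+\alpha+n)(n+1)}{2(1+\gamma+\alpha+2n)(2+\gamma+\alpha+2n)}P_{n+1}\\&-\frac{(\alpha+n)(1+\gamma+\alpha+n)(1+\gamma+\alpha+2n)}{(1+\gamma+\alpha+2n)(2+\gamma+\alpha+2n)(\gamma+\alpha+2n)}Q_n\\&+\frac{(1+\gamma)(\gamma+\alpha)+2(1+\gamma+\alpha)n+2n^2}{2(2+\gamma+\alpha+2n)(\gamma+\alpha+2n)}P_n\\&+\frac{(n+\alpha)(n+\alpha-1)}{2(1+\gamma+\alpha+2n)(2n+\gamma+\alpha)}Q_{n-1}-\frac{(n+\alpha)(n+\gamma)}{2(1+\gamma+\alpha+2n)(2n+\gamma+\alpha)}P_{n-1},\end{aligned}$$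 $$\begin{aligned}(1-x)Q_n={}&-\frac{n(2+\gamma+\alpha+n)}{2(2+\gamma+\alpha+2n)(2n+\gamma+\alpha+1)}Q_{n+1}+\frac{n(1+n)}{2(2+\gamma+\alpha+2n)(2n+\gamma+\alpha+1)}P_{n+1}\\&+\frac{(1+\gamma)(2+\gamma+\alpha)+2(1+\gamma+\alpha)n+2n^2}{2(\gamma+\alpha+2n)(2+\gamma+\alpha+2n)}Q_n-\frac{n(1+\gamma+n)}{(\gamma+\alpha+2n)(2+\gamma+\alpha+2n)}P_n\\&-\frac{(1+\gamma+n)(\alpha+n-1)}{2(\gamma+\alpha+2n)(2n+\gamma+\alpha+1)}Q_{n-1}+\frac{(1+\gamma+n)(\gamma+n)}{2(\gamma+\alpha+2n)(2n+\gamma+\alpha+1)}P_{n-1},\end{aligned}$$ where all $P_k,Q_k$ are evaluated at $(x,y)$.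
   Context: $P_n^{(a,b)}$ is the usual Jacobi polynomial on $[-1,1]$ (orthogonal for $(1-t)^a(1+t)^b$, normalized by $P_n^{(a,b)}(1)=\binom{n+a}{n}$). Here $P_0(x,y)=1$ and for $n\ge1$ $$P_n(x,y)=P_n^{(\gamma,\alpha)}(2x-1)+P_n^{(\gamma,\alpha)}(2y-1)-\binom{n+\gamma}{n},$$ $$Q_n(x,y)=(1-x)P_{n-1}^{(\gamma+2,\alpha)}(2x-1)-(1-y)P_{n-1}^{(\gamma+2,\alpha)}(2y-1).$$ *)

(* Defs.v *)
From mathcomp Require Import all_boot all_order all_algebra.
From mathcomp Require Import all_classical all_reals all_analysis.

Set Implicit Arguments.
Unset Strict Implicit.
Unset Printing Implicit Defensive.

Import Order.TTheory GRing.Theory Num.Theory.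

Local Open Scope classical_set_scope.
Local Open Scope ring_scope.

(* 'C(x, n) for a real upper argument x. *)
Definition rbinom (R : realType) (x : R) (n : nat) : R :=
  (\prod_(i < n) (x - i%:R)) / n`!%:R.

(* For a, b > -1 the integrand is absolutely integrable; the values that
   powR takes at the endpoints of the interval are irrelevant. *)
Definition is_jacobi (R : realType) (a b : R) (p : nat -> {poly R}) : Prop :=
  [/\ forall n, size (p n) = n.+1,
      forall m n, m != n ->
        (\int[lebesgue_measure]_(t in `[(-1)%R, 1%R])
           ((p m).[t] * (p n).[t] * ((1 - t) `^ a * (1 + t) `^ b))%R%:E = 0)%E
    & forall n, (p n).[1] = rbinom (n%:R + a) n].

(* The Jacobi polynomials P_n^(a, b), n = 0, 1, ...; for a, b > -1 exactly one
   family satisfies is_jacobi a b, and the default value 0 is not used. *)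
Definition jacobi (R : realType) (a b : R) : nat -> {poly R} :=
  xget (fun=> 0) [set p | is_jacobi a b p].

Definition Ppoly (R : realType) (alpha gamma : R) (n : nat) (x y : R) : R :=
  if n is 0%N then 1 else
    (jacobi gamma alpha n).[2 * x - 1] + (jacobi gamma alpha n).[2 * y - 1]
    - rbinom (n%:R + gamma) n.

(* Only meaningful for n >= 1. *)
Definition Qpoly (R : realType) (alpha gamma : R) (n : nat) (x y : R) : R :=
  (1 - x) * (jacobi (gamma + 2) alpha n.-1).[2 * x - 1]
  - (1 - y) * (jacobi (gamma + 2) alpha n.-1).[2 * y - 1].

(* Main.v *)
Require Import Defs.
From mathcomp Require Import finmap.
From mathcomp Require Import all_boot all_order all_algebra.
From mathcomp Require Import all_classical all_reals all_analysis.
From mathcomp Require Import measurable_realfun ring lra.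

Import Order.TTheory GRing.Theory Num.Theory.
Local Open Scope ring_scope.

(** The hypothesis says that (x, y) lies on one of the two lines x = 1 and
    y = 1. On either of them P_n is a one-variable Jacobi polynomial p_n of
    parameters (gamma, alpha) in the free variable, and Q_n is + q_n on y = 1
    and - q_n on x = 1, where, with w = 1 - x or w = 1 - y,
    q_n = w * P_(n-1)^(gamma+2, alpha). Multiplication by 1 - x is
    multiplication by w on the line y = 1 and by 0 on the line x = 1. Hence an
    expansion of (1 - x) P_n in terms of the P_k and Q_k amounts to two expansions
    of w p_n / 2: one in terms of the p_k (half the sum of the two lines) and one
    in terms of the q_k (half the difference). The same holds for (1 - x) Q_n.
    The four resulting univariate relations are [jacobi_relations]: the three-term
    recurrences of the families p and q, and the relations that connect the
    parameters gamma and gamma + 2. With the convention q_0 = 0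
    they hold uniformly for n >= 1, and so give both the case n = 1 and
    the general case. In the variable w the coefficients of p_n and q_n
    are explicit hypergeometric terms, and each relation becomes an identity of
    rational functions.

    The Jacobi polynomials are given by orthogonality, degree and value at 1, so
    the hypergeometric sums have to be identified with them ([jacobiE]). The
    sums are eigenvectors of the Jacobi differential operator, which is
    symmetric for the weight by the Pearson equation [jint_pearson];
    the eigenvalues are distinct, whence orthogonality. Uniqueness follows from
    the definiteness of the weighted inner product. For exponents in ]-1, 0[ the
    weight is unbounded, so integrability and the Pearson equation
    need a fundamental theorem of calculus for integrands that are singular at
    the end points. *)

(** * Hypergeometric coefficients *)

Section rising.
Set Implicit Arguments.
Unset Strict Implicit.

(** Pochhammer symbol (x)_n. *)
Definition rising (R : pzRingType) (x : R) (n : nat) : R :=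
  \prod_(i < n) (x + i%:R).
Variable R : realFieldType.
Implicit Types (x a b : R) (n k : nat).

Lemma rising0 x : rising x 0 = 1.
Proof. exact: big_ord0. Qed.

Lemma risingSr x n : rising x n.+1 = rising x n * (x + n%:R).
Proof. exact: big_ord_recr. Qed.

Lemma risingSl x n : rising x n.+1 = x * rising (x + 1) n.
Proof.
rewrite /rising big_ord_recl addr0; congr (_ * _); apply: eq_bigr => i _.
by rewrite lift0 -natr1 addrA addrAC.
Qed.

Lemma rising_gt0 x n : 0 < x -> 0 < rising x n.
Proof. by move=> x0; apply: prodr_gt0 => i _; rewrite ltr_wpDr. Qed.

Lemma rising_opp_nat n k : (n < k)%N -> rising (- n%:R : R) k = 0.
Proof.
move=> nk; apply/eqP; rewrite prodf_seq_eq0; apply/hasP.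
by exists (Ordinal nk); rewrite ?mem_index_enum//= addNr.
Qed.

(** The coefficient of w ^ k in P_n^(a, b)(1 - 2 w), that is, of
    (a + 1)_n / n! * 2F1(- n, n + a + b + 1; a + 1; w). *)
Definition jacobi_coef a b n k : R :=
  rising (a + 1) n / n`!%:R
  * (rising (- n%:R) k * rising (n%:R + a + b + 1) k)
  / (rising (a + 1) k * k`!%:R).

(** P_n^(a, b)(1 - 2 w) as a polynomial in w. *)
Definition wjacobi a b n : {poly R} := \poly_(k < n.+1) jacobi_coef a b n k.

Lemma coef_wjacobi a b n k : (wjacobi a b n)`_k = jacobi_coef a b n k.
Proof.
rewrite coef_poly ltnS; case: leqP => // nk.
by rewrite /jacobi_coef rising_opp_nat// !(mul0r, mulr0).
Qed.

(** The coefficient of w ^ k in w P_(n-1)^(a+2, b)(1 - 2 w). It is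
    the coefficient of P_n^(a, b) times - k (n + a + 1) / ((n + s) (k + a + 1)),
    s = a + b + 1; the factor n + s, which can vanish for n = 0, is cancelled
    against the first factor of (n + s)_k. Written in this way, the coefficient
    is also correct for n = 0, where the polynomial is 0. *)
Definition qjacobi_coef a b n k : R :=
  rising (a + 1) n / n`!%:R
  * (rising (- n%:R) k * rising (n%:R + a + b + 2) k.-1)
  / (rising (a + 1) k * k`!%:R)
  * (- (k%:R * (a + 1 + n%:R) / (a + 1 + k%:R))).

Definition qjacobi a b n : {poly R} := \poly_(k < n.+1) qjacobi_coef a b n k.

Lemma coef_qjacobi a b n k : (qjacobi a b n)`_k = qjacobi_coef a b n k.
Proof.
rewrite coef_poly ltnS; case: leqP => // nk.
by rewrite /qjacobi_coef rising_opp_nat// !(mul0r, mulr0).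
Qed.

Lemma qjacobi0 a b : qjacobi a b 0 = 0.
Proof.
apply/polyP => -[|k]; rewrite coef_qjacobi coef0 /qjacobi_coef.
  by rewrite !(mul0r, oppr0, mulr0).
by rewrite (@rising_opp_nat 0)// !(mul0r, mulr0).
Qed.

Lemma qjacobiS a b n : -1 < a ->
  qjacobi a b n.+1 = 'X * wjacobi (a + 2) b n.
Proof.
move=> a1; apply/polyP => k; rewrite coef_qjacobi.
have natge m : 0 <= m%:R :> R by exact: ler0n.
have rn0 m : rising (a + 1) m != 0 by rewrite gt_eqF// rising_gt0//; lra.
have fn0 m : m`!%:R != 0 :> R by rewrite pnatr_eq0 -lt0n fact_gt0.
rewrite coefXM; case: k => [|k] /=.
  by rewrite /qjacobi_coef !(mul0r, oppr0, mulr0).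
apply/esym; rewrite coef_wjacobi /jacobi_coef /qjacobi_coef /=.
have rise2 m : rising (a + 2 + 1) m =
    rising (a + 1) m * (a + 1 + m%:R) * (a + 2 + m%:R) / ((a + 1) * (a + 2)).
  have -> : a + 2 + m%:R = a + 1 + m.+1%:R by rewrite -natr1; ring.
  rewrite -!risingSr !risingSl.
  have -> : a + 1 + 1 + 1 = a + 2 + 1 by ring.
  by field; apply/andP; split; apply/eqP; lra.
rewrite !rise2 (risingSl (- n.+1%:R)) !risingSr !factS !natrM.
rewrite -(natr1 n) -(natr1 k).
have -> : - (n%:R + 1) + 1 = - n%:R :> R by ring.
have -> : n%:R + (a + 2) + b + 1 = n%:R + 1 + a + b + 2 by ring.
field.
have := natge n; have := natge k.
rewrite !rn0 !fn0 /= => ? ?; repeat (apply/andP; split); by apply/eqP; lra.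
Qed.

(** Brings the Pochhammer symbols of three consecutive arguments to the common
    factor (x + 2)_k without division. It is used both for x = - (m + 2), where
    the symbols themselves can vanish, and for x = m + a + b + 1. *)
Lemma rising_window x k :
  [/\ rising x k.+2 = x * (x + 1) * rising (x + 2) k,
      rising (x + 1) k.+2 = (x + 1) * rising (x + 2) k * (x + 2 + k%:R),
      rising (x + 2) k.+2
        = rising (x + 2) k * (x + 2 + k%:R) * (x + 3 + k%:R)
    & rising (x + 1) k.+1 = (x + 1) * rising (x + 2) k].
Proof.
have x2 : x + 1 + 1 = x + 2 by ring.
have x3 : x + 2 + k.+1%:R = x + 3 + k%:R by rewrite -natr1; ring.
by split; rewrite ?(risingSl x) ?(risingSl (x + 1)) ?x2 ?risingSr -?x3 ?mulrA.
Qed.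

Lemma rising_shift x k : x != 0 ->
  rising (x + 1) k = rising x k * (x + k%:R) / x.
Proof. by move=> x0; rewrite -risingSr risingSl mulrAC divff// mul1r. Qed.

(** The recurrence of p, the expansion of w p_n in q, the
    expansion of w q_n in p, and the recurrence of q. All of them are compared
    coefficientwise: for the coefficients of degree k + 2 every term is a rational
    multiple of one common factor, which contains (- m)_k and
    (m + a + b + 3)_k with m = n - 1; the degrees 0 and 1 are separate as they
    are too small for this factor. *)
Lemma jacobi_relations a b n : -1 < a -> -1 < b -> (0 < n)%N ->
  let N : R := n%:R in
  let p := wjacobi a b in let q := qjacobi a b in
  [/\ 'X * p n =
        ((1 + a) * (a + b) + 2 * (1 + a + b) * N + 2 * N ^+ 2)
           / ((2 + a + b + 2 * N) * (a + b + 2 * N)) *: p n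
        - (1 + a + b + N) * (N + 1)
           / ((1 + a + b + 2 * N) * (2 + a + b + 2 * N)) *: p n.+1
        - (N + b) * (N + a)
           / ((1 + a + b + 2 * N) * (2 * N + a + b)) *: p n.-1,
      'X * p n =
        (1 + a + b + N) * (N + a + b + 2)
           / ((1 + a + b + 2 * N) * (2 + a + b + 2 * N)) *: q n.+1
        - 2 * (b + N) * (1 + a + b + N)
           / ((2 + a + b + 2 * N) * (a + b + 2 * N)) *: q n
        + (N + b) * (N + b - 1)
           / ((1 + a + b + 2 * N) * (2 * N + a + b)) *: q n.-1,
      'X * q n =
        N * (1 + N)
           / ((2 + a + b + 2 * N) * (2 * N + a + b + 1)) *: p n.+1
        - 2 * N * (1 + a + N)
           / ((a + b + 2 * N) * (2 + a + b + 2 * N)) *: p n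
        + (1 + a + N) * (a + N)
           / ((a + b + 2 * N) * (2 * N + a + b + 1)) *: p n.-1
    & 'X * q n =
        ((1 + a) * (2 + a + b) + 2 * (1 + a + b) * N + 2 * N ^+ 2)
           / ((a + b + 2 * N) * (2 + a + b + 2 * N)) *: q n
        - N * (2 + a + b + N)
           / ((2 + a + b + 2 * N) * (2 * N + a + b + 1)) *: q n.+1
        - (1 + a + N) * (b + N - 1)
           / ((a + b + 2 * N) * (2 * N + a + b + 1)) *: q n.-1].
Proof.
case: n => // m a1 b1 _ N p q; rewrite {}/N {}/p {}/q succnK.
have natge j : 0 <= j%:R :> R by exact: ler0n.
have rn0 j : rising (a + 1) j != 0 by rewrite gt_eqF// rising_gt0//; lra.
have fn0 j : j`!%:R != 0 :> R by rewrite pnatr_eq0 -lt0n fact_gt0.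
have mge := natge m.
have l k := rising_window (- m.+2%:R) k.
have r k := rising_window (m%:R + a + b + 1) k.
have e1 : - m.+1%:R = - m.+2%:R + 1 :> R by rewrite -(natr1 m.+1); ring.
have e0 : - m%:R = - m.+2%:R + 2 :> R.
  by rewrite -(natr1 m.+1) -(natr1 m); ring.
have f1 : m.+1%:R + a + b + 1 = m%:R + a + b + 1 + 1.
  by rewrite -(natr1 m); ring.
have f2 : m.+2%:R + a + b + 1 = m%:R + a + b + 1 + 2.
  by rewrite -(natr1 m.+1) -(natr1 m); ring.
have g0 : m%:R + a + b + 2 = m%:R + a + b + 1 + 1 by ring.
have g1 : m.+1%:R + a + b + 2 = m%:R + a + b + 1 + 2.
  by rewrite -(natr1 m); ring.
(* The symbol for q_(m+2) starts one step too late for the common factor; its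
   missing first factor m + a + b + 3 is positive. *)
have g2 k : rising (m.+2%:R + a + b + 2) k
    = rising (m%:R + a + b + 1 + 2) k * (m%:R + a + b + 1 + 2 + k%:R)
      / (m%:R + a + b + 1 + 2).
  rewrite -rising_shift; last by apply/eqP; lra.
  by congr rising; rewrite -(natr1 m.+1) -(natr1 m); ring.
split; (apply/polyP => -[|[|k]];
  rewrite coefXM !(coefD, coefB, coefZ, coefN) ?coef_qjacobi ?coef_wjacobi;
  rewrite /qjacobi_coef /jacobi_coef /=;
  [rewrite ?g2 | rewrite ?g2 |
    have kge := natge k; have [l0 l1 l2 l3] := l k; have [r0 r1 r2 r3] := r k;
    rewrite ?g2 ?e1 ?e0 ?f1 ?f2 ?g0 ?g1 ?l0 ?l1 ?l2 ?l3 ?r0 ?r1 ?r2 ?r3;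
    rewrite -?(natr1 k.+1) -?(natr1 k) => {l0 l1 l2 l3 r0 r1 r2 r3}];
  rewrite ?risingSr ?rising0 ?factS ?fact0 ?natrM -?(natr1 m.+1) -?(natr1 m);
  rewrite -?(natr1 k.+1) -?(natr1 k) => {l r e1 e0 f1 f2 g0 g1 g2};
  field; rewrite ?rn0 ?fn0 /=; repeat (apply/andP; split); by apply/eqP; lra).
Qed.

Lemma jacobi_coefS a b n k : -1 < a ->
  (k%:R + 1) * (a + 1 + k%:R) * jacobi_coef a b n k.+1
  = (k%:R - n%:R) * (n%:R + a + b + 1 + k%:R) * jacobi_coef a b n k.
Proof.
move=> a1.
have rn0 j : rising (a + 1) j != 0 by rewrite gt_eqF// rising_gt0//; lra.
have fn0 j : j`!%:R != 0 :> R by rewrite pnatr_eq0 -lt0n fact_gt0.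
have kge : 0 <= k%:R :> R by exact: ler0n.
rewrite /jacobi_coef !risingSr factS natrM -(natr1 k).
by field; rewrite rn0 !fn0 /=; apply/andP; split; apply/eqP; lra.
Qed.

(** The hypergeometric differential equation. *)
Lemma wjacobi_ode a b n : -1 < a ->
  let H := wjacobi a b n in
  'X * (1 - 'X) * H^`()^`() + ((a + 1)%:P - (a + b + 2) *: 'X) * H^`()
  = - (n%:R * (n%:R + a + b + 1)) *: H.
Proof.
move=> a1 H.
have -> : 'X * (1 - 'X) * H^`()^`() + ((a + 1)%:P - (a + b + 2) *: 'X) * H^`()
  = 'X * H^`()^`() - 'X * ('X * H^`()^`()) + (a + 1) *: H^`()
    - (a + b + 2) *: ('X * H^`()).
  by rewrite -!mul_polyC; ring.
apply/polyP => k.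
rewrite !(coefD, coefN, coefZ, coefXM, coef_deriv) !coef_wjacobi.
have rec j :
  (j%:R + 1) * (a + 1 + j%:R) * jacobi_coef a b n j.+1
  - (j%:R - n%:R) * (n%:R + a + b + 1 + j%:R) * jacobi_coef a b n j = 0.
  by rewrite jacobi_coefS// subrr.
case: k => [|[|k]] /=; rewrite -!(mulr_natr (jacobi_coef _ _ _ _))
  -?(mulr_natr (_ * _)); apply: subr0_eq.
- by rewrite -[RHS](rec 0); ring.
- by rewrite -[RHS](rec 1); ring.
- by rewrite -[RHS](rec k.+2) -(natr1 k.+2) -(natr1 k.+1) -(natr1 k); ring.
Qed.

Lemma size_wjacobi a b n : -1 < a -> -1 < b -> size (wjacobi a b n) = n.+1.
Proof.
move=> a1 b1; apply: size_poly_eq; rewrite /jacobi_coef.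
have ra : rising (a + 1) n != 0 by rewrite gt_eqF// rising_gt0//; lra.
have fn : n`!%:R != 0 :> R by rewrite pnatr_eq0 -lt0n fact_gt0.
have rm : rising (- n%:R : R) n != 0.
  apply/prodf_neq0 => i _; rewrite addrC subr_eq0 eqr_nat.
  by rewrite neq_ltn ltn_ord.
have rs : rising (n%:R + a + b + 1) n != 0.
  case: n {ra fn rm} => [|n]; first by rewrite rising0 oner_eq0.
  have nge : 0 <= n%:R :> R by exact: ler0n.
  by rewrite gt_eqF// rising_gt0// -natr1; lra.
by rewrite !(mulf_neq0, invr_eq0).
Qed.

End rising.

(** * Integrals with singularities at the end points *)

Section ftc_singular.
Import numFieldNormedType.Exports.
Set Implicit Arguments.
Unset Strict Implicit.
Local Open Scope classical_set_scope.
Local Open Scope ring_scope.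
Variable R : realType.
Notation mu := (@lebesgue_measure R).
Variables (f F : R -> R) (c d : R).
Hypotheses (cd : c < d) (cf : forall x, c < x < d -> {for x, continuous f}).
Hypothesis dF : forall x, c < x < d -> is_derive x (1 : R) F (f x).
Hypothesis cF : {within `[c, d], continuous F}.

(** The integral up to x and F are both continuous on the closed interval and
    have the same derivative inside, so their difference is constant by the mean
    value theorem. *)
Lemma Rintegral_FTC2_singular : mu.-integrable `[c, d] (EFin \o f) ->
  (\int[mu]_(x in `[c, d]) f x)%R = F d - F c.
Proof.
move=> intf; pose I := parameterized_integral mu c ^~ f.
have cI : {within `[c, d], continuous I}.
  exact: parameterized_integral_continuous (ltW cd) intf.
have dI x : x \in `]c, d[ -> is_derive x (1 : R) (I \- F) 0.
  rewrite in_itv/= => xcd; have /andP[cx xd] := xcd.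
  have [I1 I2] := continuous_FTC1_closed xd intf cx (cf xcd).
  have dIx : is_derive x (1 : R) I (f x).
    by apply: DeriveDef; rewrite -?derive1E.
  have := dF xcd => dFx; have := is_deriveB dIx dFx.
  by rewrite subrr.
have cIF : {within `[c, d], continuous (I \- F)}.
  by move=> x; apply: continuousB; [exact: cI|exact: cF].
have [x _] := MVT cd dI cIF; rewrite mul0r /I /=.
rewrite {2}/parameterized_integral set_itv1 Rintegral_set1 sub0r opprK.
by rewrite /parameterized_integral; lra.
Qed.

Hypothesis f0 : forall x, c < x < d -> 0 <= f x.

(** Monotone convergence along an exhaustion of the open interval by segments:
    on each of them the integral is an increment of the nondecreasing F, hence
    at most F d - F c. *)
Lemma integrable_FTC2_singular : mu.-integrable `[c, d] (EFin \o f).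
Proof.
(* The shift by 3 leaves the segments nondegenerate from the first one on. *)
pose e n := (d - c) / n.+3%:R.
have e0 n : 0 < e n by rewrite divr_gt0 ?subr_gt0.
pose G n : set R := `[c + e n, d - e n]%classic.
have Gcd n x : G n x -> c < x < d.
  by rewrite /G/= in_itv/= => /andP[? ?]; have := e0 n; lra.
have GE : \bigcup_n G n = `]c, d[%classic.
  apply/seteqP; split => [x [n _ /Gcd]|x]; rewrite /= in_itv//= => /andP[cx xd].
  pose r := Num.min (x - c) (d - x).
  have r0 : 0 < r by rewrite lt_min !subr_gt0 cx.
  exists (Num.trunc ((d - c) / r)) => //.
  have : e (Num.trunc ((d - c) / r)) <= r.
    rewrite /e ler_pdivrMr// mulrC -ler_pdivrMr//.
    apply: le_trans (ltW (truncnS_gt _)) _.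
    by rewrite ler_nat -addn2 leq_addr.
  rewrite /r le_min => /andP[? ?].
  by rewrite /G/= in_itv/=; apply/andP; split; lra.
have mfoo : measurable_fun `]c, d[ f.
  apply: open_continuous_measurable_fun => // x.
  by rewrite inE/= in_itv/=; exact: cf.
have mf : measurable_fun `[c, d] f.
  apply/measurable_fun_itv_obnd_cbndP.
  exact/measurable_fun_itv_bndo_bndcP.
have ndG : nondecreasing_seq G.
  move=> m n mn; rewrite subsetEset => x; rewrite /G/= !in_itv/= => /andP[? ?].
  have : e n <= e m.
    by rewrite /e ler_pM2l ?subr_gt0// lef_pV2 ?posrE// ler_nat.
  by move=> ?; apply/andP; split; lra.
have GI n : (\int[mu]_(x in G n) (f x)%:E <= (F d - F c)%:E)%E.
  have en0 := e0 n.
  have en1 : e n * 3 <= d - c.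
    by rewrite /e -mulrA ger_pMr ?subr_gt0// mulrC ler_pdivrMr// mul1r ler_nat.
  have sub u v : c <= u -> v <= d -> `[u, v] `<=` `[c, d].
    move=> cu vd x; rewrite /= !in_itv/= => /andP[? ?].
    by apply/andP; split; lra.
  have mono u v : c <= u -> u < v -> v <= d -> F u <= F v.
    move=> cu uv vd; have [||x] := @MVT _ F f u v uv.
    - move=> x; rewrite in_itv/= => /andP[? ?].
      by apply: dF; apply/andP; split; lra.
    - by apply: continuous_subspaceW cF; exact: sub.
    rewrite in_itv/= => /andP[? ?] E; rewrite -subr_ge0 E mulr_ge0//; last lra.
    by apply/f0/andP; split; lra.
  rewrite (@continuous_FTC2 _ f F).
  - rewrite -EFinB lee_fin.
    have : F c <= F (c + e n) by apply: mono; lra.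
    have : F (d - e n) <= F d by apply: mono; lra.
    lra.
  - lra.
  - apply: continuous_in_subspaceT => x; rewrite inE => /Gcd; exact: cf.
  - have /continuous_within_itvP : {within `[c + e n, d - e n], continuous F}.
      by apply: continuous_subspaceW cF; apply: sub; lra.
    move=> [|_ ? ?]; first lra.
    split=> // x; rewrite in_itv/= => /andP[? ?].
    have /dF[] // : c < x < d by apply/andP; split; lra.
  - move=> x; rewrite in_itv/= => /andP[? ?].
    have /dF[_ <-] : c < x < d by apply/andP; split; lra.
    by rewrite derive1E.
apply/integrableP; split; first exact/measurable_EFinP.
rewrite integral_itv_bndoo; last exact/measurableT_comp/measurable_EFinP.
rewrite (_ : (\int[mu]_(x in _) _)%E
  = (\int[mu]_(x in `]c, d[) (f x)%:E)%E); last first.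
  apply: eq_integral => x; rewrite inE/= in_itv/= => /f0 fx.
  by rewrite ger0_norm.
rewrite -GE; apply: (@le_lt_trans _ _ (F d - F c)%:E); last exact: ltry.
have mG n : measurable (G n) by exact: measurable_itv.
have mfG n : measurable_fun (G n) (EFin \o f).
  apply/measurable_EFinP; apply: measurable_funS mfoo => // x /Gcd.
  by rewrite /= in_itv.
have fG n x : G n x -> (0 <= (EFin \o f) x)%E by move=> /Gcd /f0.
apply: cvge_le; last first.
  exact: ge0_nondecreasing_set_cvg_integral.
  exact: nearW.
exact: eventually_filter.
Qed.

End ftc_singular.

(** * The Jacobi weight *)

Section powR_affine.
Import numFieldNormedType.Exports.
Set Implicit Arguments.
Unset Strict Implicit.
Local Open Scope classical_set_scope.
Local Open Scope ring_scope.
Variable R : realType.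
Implicit Types c t : R.

Lemma within_continuousM (A : set R) (f g : R -> R) :
  {within A, continuous f} -> {within A, continuous g} ->
  {within A, continuous (fun x => f x * g x)}.
Proof. by move=> cf cg x; apply: cvgM; [exact: cf|exact: cg]. Qed.

Lemma is_derive_powR_subl c t : t < 1 ->
  is_derive t (1 : R) (fun t => (1 - t) `^ c) (- c * (1 - t) `^ (c - 1)).
Proof.
move=> t1; have t0 : 0 < 1 - t by lra.
have d1 : is_derive t (1 : R) (fun t => 1 - t) (-1).
  by apply: is_derive_eq; rewrite add0r mul1r.
have := @is_derive1_comp R (@powR R ^~ c) (fun t => 1 - t) _ _ _
  (is_derive1_powR c t0) d1.
by rewrite mulrN1 mulNr.
Qed.

Lemma is_derive_powR_addl c t : -1 < t ->
  is_derive t (1 : R) (fun t => (1 + t) `^ c) (c * (1 + t) `^ (c - 1)).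
Proof.
move=> t1; have t0 : 0 < 1 + t by lra.
have d1 : is_derive t (1 : R) (fun t => 1 + t) 1.
  by apply: is_derive_eq; rewrite ?add0r ?mul1r.
have := @is_derive1_comp R (@powR R ^~ c) (fun t => 1 + t) _ _ _
  (is_derive1_powR c t0) d1.
by rewrite mulr1.
Qed.

Lemma continuous_powR_subl c t : t < 1 ->
  {for t, continuous (fun t => (1 - t) `^ c)}.
Proof.
move=> /(is_derive_powR_subl c) [dt _].
exact/differentiable_continuous/derivable1_diffP.
Qed.

Lemma continuous_powR_addl c t : -1 < t ->
  {for t, continuous (fun t => (1 + t) `^ c)}.
Proof.
move=> /(is_derive_powR_addl c) [dt _].
exact/differentiable_continuous/derivable1_diffP.
Qed.

Lemma cvg_powR_addl c : 0 < c ->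
  (fun t => (1 + t) `^ c) @ (-1)^'+ --> (0 : R).
Proof.
move=> c0; apply: cvg_comp (powR_cvg0 c0) => A [e e0 eA].
exists e => //= t; rewrite /ball_/= => te t1; apply: eA => /=; last lra.
by rewrite sub0r opprD.
Qed.

Lemma cvg_powR_subl c : 0 < c ->
  (fun t => (1 - t) `^ c) @ 1^'- --> (0 : R).
Proof.
move=> c0; apply/cvg_at_leftNP.
rewrite (_ : _ \o _ = fun t => (1 + t) `^ c); first exact: cvg_powR_addl.
by apply/funext => t /=; rewrite opprK.
Qed.

Lemma within_continuous_powR_subl c : 0 < c ->
  {within `[-1, 1], continuous (fun t : R => (1 - t) `^ c)}.
Proof.
move=> c0; have m11 : -1 < 1 :> R by lra.
apply/(continuous_within_itvP _ m11); split.
- by move=> t; rewrite in_itv/= => /andP[_]; exact: continuous_powR_subl.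
- by apply: cvg_at_right_filter; exact: continuous_powR_subl.
- by rewrite subrr powR0 ?gt_eqF//; exact: cvg_powR_subl.
Qed.

Lemma within_continuous_powR_addl c : 0 < c ->
  {within `[-1, 1], continuous (fun t : R => (1 + t) `^ c)}.
Proof.
move=> c0; have m11 : -1 < 1 :> R by lra.
apply/(continuous_within_itvP _ m11); split.
- by move=> t; rewrite in_itv/= => /andP[+ _]; exact: continuous_powR_addl.
- by rewrite subrr powR0 ?gt_eqF//; exact: cvg_powR_addl.
- by apply: cvg_at_left_filter; apply: continuous_powR_addl; lra.
Qed.

End powR_affine.

Section weight.
Import numFieldNormedType.Exports.
Set Implicit Arguments.
Unset Strict Implicit.
Local Open Scope classical_set_scope.
Local Open Scope ring_scope.
Variables (R : realType) (a b : R).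
Notation mu := (@lebesgue_measure R).

Lemma integrable_powR_subl : -1 < a ->
  mu.-integrable `[-1, 1] (EFin \o (fun t => (1 - t) `^ a)).
Proof.
move=> a1; have a0 : a + 1 != 0 by rewrite gt_eqF//; lra.
apply: (@integrable_FTC2_singular _ _
  (fun t => - (a + 1)^-1 * (1 - t) `^ (a + 1))).
- lra.
- by move=> t /andP[_]; exact: continuous_powR_subl.
- move=> t /andP[_ t1].
  have dt := is_derive_powR_subl (a + 1) t1.
  apply: is_derive_eq; rewrite addrK /GRing.scale/= mulrA ?mulrNN.
  by rewrite mulVf ?mul1r.
- apply: within_continuousM; first by move=> x; exact: cvg_cst.
  by apply: within_continuous_powR_subl; lra.
- by move=> t _; exact: powR_ge0.
Qed.

Lemma integrable_powR_addl : -1 < b ->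
  mu.-integrable `[-1, 1] (EFin \o (fun t => (1 + t) `^ b)).
Proof.
move=> b1; have b0 : b + 1 != 0 by rewrite gt_eqF//; lra.
apply: (@integrable_FTC2_singular _ _
  (fun t => (b + 1)^-1 * (1 + t) `^ (b + 1))).
- lra.
- by move=> t /andP[+ _]; exact: continuous_powR_addl.
- move=> t /andP[t1 _].
  have dt := is_derive_powR_addl (b + 1) t1.
  apply: is_derive_eq; rewrite addrK /GRing.scale/= mulrA ?mulrNN.
  by rewrite mulVf ?mul1r.
- apply: within_continuousM; first by move=> x; exact: cvg_cst.
  by apply: within_continuous_powR_addl; lra.
- by move=> t _; exact: powR_ge0.
Qed.

Definition weight (t : R) : R := (1 - t) `^ a * (1 + t) `^ b.

Lemma weight_gt0 t : -1 < t < 1 -> 0 < weight t.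
Proof. by move=> ?; rewrite mulr_gt0// powR_gt0//; lra. Qed.

Lemma measurable_weight : measurable_fun setT weight.
Proof.
apply: measurable_funM.
- apply: (measurableT_comp (measurable_powR _)); exact: measurable_funB.
- apply: (measurableT_comp (measurable_powR _)); exact: measurable_funD.
Qed.

(** On each half of the segment one of the two factors is bounded, by 2 to the
    absolute value of its exponent; so the weight is dominated by a multiple of
    (1 - t) ^ a + (1 + t) ^ b. *)
Lemma integrable_weight : -1 < a -> -1 < b ->
  mu.-integrable `[-1, 1] (EFin \o weight).
Proof.
move=> a1 b1; have bnd (c s : R) : 1 <= s -> s <= 2 -> s `^ c <= 2 `^ `|c|.
  move=> s1 s2; apply: (@le_trans _ _ (s `^ `|c|)).
    by rewrite ler_powR// ler_norm.
  by apply: ge0_ler_powR; rewrite ?nnegrE//; lra.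
pose C := 2 `^ `|a| + 2 `^ `|b|.
have iC : mu.-integrable `[-1, 1]
    (fun t => C%:E * (((1 - t) `^ a)%:E + ((1 + t) `^ b)%:E))%E.
  apply: integrableZl => //; apply: integrableD => //.
    exact: integrable_powR_subl.
  exact: integrable_powR_addl.
apply: le_integrable iC => //.
  by apply/measurable_EFinP; apply: measurable_funS measurable_weight.
move=> t; rewrite /= in_itv/= => /andP[t1 t2].
rewrite lee_fin.
have p1 := powR_ge0 (1 - t) a; have p2 := powR_ge0 (1 + t) b.
have p3 := powR_ge0 2 `|a|; have p4 := powR_ge0 2 `|b|.
rewrite !ger0_norm ?mulr_ge0 ?addr_ge0//.
rewrite /weight /C; have [t0|t0] := leP 0 t.
  have : (1 + t) `^ b <= 2 `^ `|b| by apply: bnd; lra.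
  nra.
have : (1 - t) `^ a <= 2 `^ `|a| by apply: bnd; lra.
nra.
Qed.

End weight.

(** * The weighted integral of a polynomial *)

Section jacobi_functional.
Import numFieldNormedType.Exports.
Set Implicit Arguments.
Unset Strict Implicit.
Local Open Scope classical_set_scope.
Local Open Scope ring_scope.
Variables (R : realType) (a b : R).
Notation mu := (@lebesgue_measure R).
Hypotheses (a1 : -1 < a) (b1 : -1 < b).
Implicit Types p q r : {poly R}.

Definition jint p : R := \int[mu]_(t in `[-1, 1]) (p.[t] * weight a b t).

Lemma integrable_poly_weight p :
  mu.-integrable `[-1, 1] (EFin \o (fun t => p.[t] * weight a b t)).
Proof.
have cp : {within `[-1, 1], continuous (horner p)}.
  by apply: continuous_subspaceT; exact: continuous_horner.
pose h : R -> R := horner p.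
have mp : measurable_fun `[(-1 : R), 1] h.
  by apply: subspace_continuous_measurable_fun.
have : mu.-integrable `[-1, 1] ((EFin \o h) \* (EFin \o weight a b))%E.
  apply: integrableMr => //; last exact: integrable_weight.
  have /compact_bounded[M [_ pM]] :=
    continuous_compact cp (@segment_compact R (-1) 1).
  exists M; split; rewrite ?num_real // => x Mx t tD.
  by apply: (pM x Mx); exists t.
by [].
Qed.

Lemma EFin_jint p :
  (\int[mu]_(t in `[(-1)%R, 1%R]) (p.[t] * weight a b t)%R%:E)%E = (jint p)%:E.
Proof.
rewrite /jint /Rintegral fineK// integrable_fin_num//.
exact: integrable_poly_weight.
Qed.

Lemma jintD p q : jint (p + q) = jint p + jint q.
Proof.
rewrite /jint -RintegralD//; [|exact: integrable_poly_weight..].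
by apply: eq_Rintegral => t _; rewrite hornerD mulrDl.
Qed.

Lemma jintZ c p : jint (c *: p) = c * jint p.
Proof.
rewrite /jint -RintegralZl//; [|exact: integrable_poly_weight].
by apply: eq_Rintegral => t _; rewrite hornerZ -mulrA.
Qed.

Lemma jintB p q : jint (p - q) = jint p - jint q.
Proof. by rewrite -[- q]scaleN1r jintD jintZ mulN1r. Qed.

(** The integrand is the derivative of
    (1 - t) ^ (a + 1) * (1 + t) ^ (b + 1) * r(t), which vanishes at both end
    points since a + 1 and b + 1 are positive. *)
Lemma jint_pearson r :
  jint ((b + 1) *: ((1 - 'X) * r) - (a + 1) *: ((1 + 'X) * r)
        + (1 - 'X) * (1 + 'X) * r^`()) = 0.
Proof.
pose F t := (1 - t) `^ (a + 1) * (1 + t) `^ (b + 1) * r.[t].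
have m11 : -1 < 1 :> R by lra.
transitivity (F 1 - F (-1)); last first.
  have a0 : a + 1 != 0 by rewrite gt_eqF// -ltrBlDr sub0r.
  have b0 : b + 1 != 0 by rewrite gt_eqF// -ltrBlDr sub0r.
  by rewrite /F !subrr !powR0// !(mul0r, mulr0) subrr.
apply: Rintegral_FTC2_singular => //.
- move=> t /andP[t1 t2]; apply: continuousM; first exact: continuous_horner.
  by apply: continuousM; [exact: continuous_powR_subl|exact: continuous_powR_addl].
- move=> t /andP[t1 t2].
  have dl := is_derive_powR_subl (a + 1) t2.
  have dr := is_derive_powR_addl (b + 1) t1.
  have dp := is_derive_poly r t.
  apply: is_derive_eq; rewrite /GRing.scale/= /weight -!polyC1.
  rewrite !(hornerD, hornerN, hornerZ, hornerM, hornerC, hornerX) !addrK.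
  have t20 : 1 - t != 0 by rewrite subr_eq0 gt_eqF.
  have t10 : 1 + t != 0 by rewrite addrC -[1]opprK subr_eq0 gt_eqF.
  rewrite (@powRD _ (1 - t) a 1) ?t20 ?implybT//.
  rewrite (@powRD _ (1 + t) b 1) ?t10 ?implybT//.
  rewrite !powRr1 ?subr_ge0 ?(ltW t2)//; last lra.
  ring.
- apply: within_continuousM; last first.
    by apply: continuous_subspaceT; exact: continuous_horner.
  apply: within_continuousM.
    by apply: within_continuous_powR_subl; rewrite -ltrBlDr sub0r.
  by apply: within_continuous_powR_addl; rewrite -ltrBlDr sub0r.
- exact: integrable_poly_weight.
Qed.

(** If the integral vanishes, then r vanishes at almost every point of
    the segment, hence at infinitely many points. *)
Lemma jint_sqr_eq0 r : jint (r * r) = 0 -> r = 0.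
Proof.
move=> r0.
pose g t := (r * r).[t] * weight a b t.
have mg : measurable_fun `[(-1 : R), 1] (EFin \o g).
  exact: measurable_int (integrable_poly_weight _).
have w0 t : 0 <= weight a b t by rewrite mulr_ge0 ?powR_ge0.
have : (\int[mu]_(t in `[(-1)%R, 1%R]) `|(EFin \o g) t|)%E = 0.
  rewrite -[RHS]/(0%:E) -r0 -EFin_jint; apply: eq_integral => t _ /=.
  by rewrite ger0_norm// /g hornerM mulr_ge0// -expr2 sqr_ge0.
rewrite ae_eq_integral_abs// => -[N [mN N0 gN]].
pose A := `]-1, 1[%classic `\` N.
have mA : measurable A by apply: measurableD.
have [fA|/infinite_set_fset iA] := pselect (finite_set A).
  have /eqP : mu `]-1, 1[%classic = 0.
    apply: (@subset_measure0 _ _ _ mu _ (A `|` N)) => //.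
    - by apply: measurableU.
    - by move=> x x11; have [xN|xN] := pselect (N x); [right|left].
    - apply: null_set_setU => //.
      exact/countable_lebesgue_measure0/finite_set_countable.
  have m11 : -1 < 1 :> R by exact: gtrN.
  by rewrite lebesgue_measure_itv/= lte_fin m11 -EFinD eqe opprK gt_eqF.
have [B BA sB] := iA (size r).
apply: (@roots_geq_poly_eq0 _ _ (enum_fset B)); rewrite ?fset_uniq//.
apply/allP => t /BA[]; rewrite /= in_itv/= => t11 tN.
have : g t = 0.
  apply: contrapT => gt0; apply: tN; apply: gN => /= gD; apply: gt0.
  apply: EFin_inj; apply: gD.
  by rewrite in_itv/=; case/andP: t11 => *; apply/andP; split; exact: ltW.
move/eqP; rewrite /g mulf_eq0 (gt_eqF (weight_gt0 a b t11)) orbF.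
by rewrite hornerM mulf_eq0 orbb.
Qed.

End jacobi_functional.

(** * Identification of the Jacobi polynomials *)

Section jacobi_identification.
Import numFieldNormedType.Exports.
Set Implicit Arguments.
Unset Strict Implicit.
Local Open Scope classical_set_scope.
Local Open Scope ring_scope.
Variables (R : realType) (a b : R).
Notation mu := (@lebesgue_measure R).
Implicit Types p q r : {poly R}.

(** The Jacobi operator (1 - t^2) p'' + (b - a - (a + b + 2) t) p', with the
    first-order part in the shape of the Pearson equation. *)
Definition jacobi_op p : {poly R} :=
  (b + 1) *: ((1 - 'X) * p^`()) - (a + 1) *: ((1 + 'X) * p^`())
  + (1 - 'X) * (1 + 'X) * p^`()^`().

(** By the Pearson equation for r = p' q, the integral of (jacobi_op p) q is
    minus the integral of (1 - t^2) p' q', which is symmetric in p and q. *)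
Lemma jacobi_op_sym p q : -1 < a -> -1 < b ->
  jint a b (jacobi_op p * q) = jint a b (jacobi_op q * p).
Proof.
move=> a1 b1.
have green u v : jint a b (jacobi_op u * v)
    = - jint a b ((1 - 'X) * (1 + 'X) * (u^`() * v^`())).
  apply/eqP; rewrite -addr_eq0 -jintD// -(jint_pearson a1 b1 (u^`() * v)).
  by apply/eqP; congr jint; rewrite /jacobi_op derivM -!mul_polyC; ring.
by rewrite !green [p^`() * _]mulrC.
Qed.

Definition explicit_jacobi n : {poly R} :=
  wjacobi a b n \Po (2^-1 *: (1 - 'X)).

Lemma horner_explicit_jacobi n t :
  (explicit_jacobi n).[t] = (wjacobi a b n).[(1 - t) / 2].
Proof. by rewrite horner_comp !hornerE mulrC. Qed.

(** The hypergeometric equation in the variable t = 1 - 2 w. *)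
Lemma explicit_jacobi_eigen n : -1 < a ->
  jacobi_op (explicit_jacobi n)
  = - (n%:R * (n%:R + a + b + 1)) *: explicit_jacobi n.
Proof.
move=> a1; set h : {poly R} := 2^-1 *: (1 - 'X).
have dh : h^`() = - (2^-1)%:P.
  by rewrite /h derivZ derivB derivC derivX sub0r scalerN alg_polyC.
have h2 : (2^-1)%:P + (2^-1)%:P = 1 :> {poly R}.
  by rewrite -polyCD -[RHS]polyC1; congr (_%:P); lra.
have dbl (u : {poly R}) : u * (2^-1)%:P + u * (2^-1)%:P = u.
  by rewrite -mulrDr h2 mulr1.
have := congr1 (comp_poly h) (wjacobi_ode b n a1).
rewrite comp_polyZ !(comp_polyB, comp_polyD, comp_polyM, comp_polyZ).
rewrite !(comp_polyC, comp_polyX).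
rewrite -/(explicit_jacobi n) => <-.
rewrite /jacobi_op /explicit_jacobi !deriv_comp -/h derivM deriv_comp dh.
rewrite derivN derivC.
have -> : 'X = 1 - h - h :> {poly R}.
  by rewrite -addrA -opprD -scalerDl -mul_polyC polyCD h2; ring.
(* Each differentiation of the composition brings a factor - 1/2. The other
   side is multiplied by 1/2 + 1/2, once for the first and twice for the second
   derivative; after that, the identity is polynomial in the constant 1/2. *)
move: (_ \Po h) (_ \Po h) => u2 u1.
rewrite -[in RHS](dbl u2) -[in RHS](dbl (u2 * _)) -[in RHS](dbl u1).
rewrite -!mul_polyC !(polyCD, polyCMn, polyC1).
ring.
Qed.

(** Eigenvectors of a symmetric operator. The difference of the eigenvalues is
    (n - m) (n + m + a + b + 1), whose second factor is positive because
    n + m >= 1. *)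
Lemma explicit_jacobi_orth m n : -1 < a -> -1 < b -> m != n ->
  jint a b (explicit_jacobi m * explicit_jacobi n) = 0.
Proof.
move=> a1 b1 mn.
have eig i j : jint a b (jacobi_op (explicit_jacobi i) * explicit_jacobi j)
    = - (i%:R * (i%:R + a + b + 1))
      * jint a b (explicit_jacobi i * explicit_jacobi j).
  by rewrite explicit_jacobi_eigen// -scalerAl jintZ.
have := jacobi_op_sym (explicit_jacobi m) (explicit_jacobi n) a1 b1.
rewrite eig eig (mulrC (explicit_jacobi n)) => /eqP.
rewrite -subr_eq0 -mulrBl mulf_eq0 => /orP[|/eqP//].
have -> : - (m%:R * (m%:R + a + b + 1)) - - (n%:R * (n%:R + a + b + 1))
    = (n%:R - m%:R) * (n%:R + m%:R + a + b + 1) :> R by ring.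
rewrite mulf_eq0 subr_eq0 eqr_nat eq_sym (negbTE mn)/= gt_eqF//.
have : 1 <= n%:R + m%:R :> R.
  rewrite -natrD ler1n lt0n addn_eq0.
  by apply: contraNN mn => /andP[/eqP-> /eqP->].
lra.
Qed.

Lemma rbinom_rising n : rbinom (n%:R + a) n = rising (a + 1) n / n`!%:R.
Proof.
rewrite /rbinom /rising; congr (_ / _).
rewrite (reindex_inj rev_ord_inj) /=; apply: eq_bigr => i _.
rewrite natrB ?ltn_ord// -natr1; ring.
Qed.

Lemma rbinom_neq0 n : -1 < a -> rbinom (n%:R + a) n != 0.
Proof.
move=> a1; rewrite rbinom_rising gt_eqF// divr_gt0 ?ltr0n ?fact_gt0//.
by apply: rising_gt0; lra.
Qed.

(** The p m with m < n span the polynomials of size at most n. *)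
Lemma jacobi_orth_lower (p : nat -> {poly R}) n r :
  -1 < a -> -1 < b -> (forall n, size (p n) = n.+1) ->
  (forall m n, m != n -> jint a b (p m * p n) = 0) ->
  (size r <= n)%N -> jint a b (p n * r) = 0.
Proof.
move=> a1 b1 sp op.
suff H m : (m <= n)%N -> forall r, (size r <= m)%N -> jint a b (p n * r) = 0.
  exact: H.
elim: m => [|m IH] mn {}r sr.
  move: sr; rewrite leqn0 size_poly_eq0 => /eqP ->.
  by rewrite mulr0 -(scale0r 0) jintZ// mul0r.
pose c := r`_m / lead_coef (p m).
have -> : p n * r = p n * (r - c *: p m) + c *: (p n * p m).
  by rewrite mulrBr -scalerAr subrK.
rewrite jintD// jintZ// op ?gt_eqF// mulr0 addr0 IH// ?(ltnW mn)//.
apply/leq_sizeP => j; rewrite leq_eqVlt => /predU1P[<-|mj].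
  rewrite coefB coefZ /c lead_coefE sp /= divfK ?subrr//.
  have := lead_coef_eq0 (p m); rewrite lead_coefE sp /= => ->.
  by rewrite -size_poly_eq0 sp.
rewrite coefB coefZ !nth_default ?mulr0 ?subrr// ?sp//.
exact: leq_trans sr _.
Qed.

Lemma is_jacobi_jint (p : nat -> {poly R}) : -1 < a -> -1 < b ->
  is_jacobi a b p <-> [/\ forall n, size (p n) = n.+1,
    forall m n, m != n -> jint a b (p m * p n) = 0
    & forall n, (p n).[1] = rbinom (n%:R + a) n].
Proof.
move=> a1 b1.
have E m n : (\int[mu]_(t in `[(-1)%R, 1%R])
    ((p m).[t] * (p n).[t] * ((1 - t) `^ a * (1 + t) `^ b))%R%:E)%E
    = (jint a b (p m * p n))%:E.
  by rewrite -EFin_jint//; apply: eq_integral => t _; rewrite hornerM.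
split=> -[sp op p1]; split=> // m n /op; rewrite E; first by move=> [].
by move=> ->.
Qed.

(** The combination of p n and q n that cancels the leading terms is of
    lower degree, hence orthogonal to p n and to q n and so to itself; it is
    therefore 0. The proportionality factor is 1 since the common value at 1 is
    not 0. *)
Lemma is_jacobi_unique (p q : nat -> {poly R}) : -1 < a -> -1 < b ->
  is_jacobi a b p -> is_jacobi a b q -> p = q.
Proof.
move=> a1 b1 /(is_jacobi_jint _ a1 b1)[sp op p1].
move=> /(is_jacobi_jint _ a1 b1)[sq oq q1].
apply/funext => n.
have lq0 : lead_coef (q n) != 0 by rewrite lead_coef_eq0 -size_poly_eq0 sq.
pose c := lead_coef (p n) / lead_coef (q n).
pose r := p n - c *: q n.
have sr : (size r <= n)%N.
  apply/leq_sizeP => j; rewrite leq_eqVlt => /predU1P[<-|nj].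
    rewrite coefB coefZ /c !lead_coefE sp sq /= divfK ?subrr//.
    by move: lq0; rewrite lead_coefE sq.
  by rewrite coefB coefZ !nth_default ?mulr0 ?subrr// ?sp ?sq.
have pqc : p n = c *: q n.
  apply/eqP; rewrite -subr_eq0; apply/eqP; apply: (jint_sqr_eq0 a1 b1).
  rewrite -/r {1}/r mulrBl -scalerAl jintB// jintZ//.
  by rewrite !(@jacobi_orth_lower _ n r a1 b1) ?mulr0 ?subrr.
have := p1 n; rewrite {1}pqc hornerZ q1 => /eqP.
rewrite -[X in _ == X]mul1r (inj_eq (mulIf (rbinom_neq0 n a1))) => /eqP c1.
by rewrite pqc c1 scale1r.
Qed.

Lemma is_jacobi_explicit : -1 < a -> -1 < b -> is_jacobi a b explicit_jacobi.
Proof.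
move=> a1 b1; apply/is_jacobi_jint => //; split.
- move=> n; rewrite size_comp_poly2 ?size_wjacobi//.
  rewrite size_scale ?invr_eq0 ?pnatr_eq0// -opprB size_polyN.
  by rewrite -polyC1 size_XsubC.
- by move=> m n mn; exact: explicit_jacobi_orth.
- move=> n; rewrite horner_explicit_jacobi subrr mul0r horner_coef0 coef_wjacobi.
  by rewrite rbinom_rising /jacobi_coef !rising0 fact0 !mulr1 divr1.
Qed.

Lemma jacobiE : -1 < a -> -1 < b -> jacobi a b = explicit_jacobi.
Proof.
move=> a1 b1; apply: is_jacobi_unique => //; last exact: is_jacobi_explicit.
apply: (@xgetPex _ _ [set p | is_jacobi a b p]).
by exists explicit_jacobi; exact: is_jacobi_explicit.
Qed.

End jacobi_identification.

(** * The two lines x = 1 and y = 1 *)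

Section lines.
Set Implicit Arguments.
Unset Strict Implicit.

Lemma wjacobi0 (R : realFieldType) (a b : R) : wjacobi a b 0 = 1.
Proof.
apply/polyP => k; rewrite coef_wjacobi coef1 /jacobi_coef.
case: k => [|k]; first by rewrite !rising0 fact0 !mulr1 !divr1.
by rewrite (@rising_opp_nat _ 0)// !(mul0r, mulr0).
Qed.

Lemma wjacobi1 (R : realFieldType) (a b : R) : -1 < a ->
  wjacobi a b 1 = (a + 1)%:P - (a + b + 2) *: 'X.
Proof.
move=> a1; apply/polyP => k; rewrite coef_wjacobi coefB coefC coefZ coefX.
rewrite /jacobi_coef; case: k => [|[|k]] /=.
- by rewrite !risingSr !rising0 fact0 /= factS fact0; field.
- rewrite !risingSr !rising0 !factS !fact0 /=; field.
  by apply/eqP; lra.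
- by rewrite (@rising_opp_nat _ 1)// !(mul0r, mulr0) subrr.
Qed.

Variables (R : realType) (alpha gamma : R).

Lemma jacobi_horner (a b t : R) n : -1 < a -> -1 < b ->
  (jacobi a b n).[2 * t - 1] = (wjacobi a b n).[1 - t].
Proof.
move=> a1 b1; rewrite jacobiE// horner_explicit_jacobi; congr (_.[_]).
by field.
Qed.

Lemma wjacobi_at0 (a b : R) n : (wjacobi a b n).[0] = rbinom (n%:R + a) n.
Proof.
rewrite horner_coef0 coef_wjacobi rbinom_rising.
by rewrite /jacobi_coef !rising0 fact0 !mulr1 divr1.
Qed.

Lemma PpolyE n x y : -1 < alpha -> -1 < gamma -> Ppoly alpha gamma n x y
  = (wjacobi gamma alpha n).[1 - x] + (wjacobi gamma alpha n).[1 - y]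
    - (wjacobi gamma alpha n).[0].
Proof.
move=> al ga.
case: n => [|n]; last by rewrite /Ppoly !jacobi_horner// wjacobi_at0.
by rewrite wjacobi0 -polyC1 !hornerC addrK.
Qed.

Lemma QpolyE n x y : -1 < alpha -> -1 < gamma -> (0 < n)%N ->
  Qpoly alpha gamma n x y
  = (qjacobi gamma alpha n).[1 - x] - (qjacobi gamma alpha n).[1 - y].
Proof.
move=> al ga; case: n => // n _.
have g2 : -1 < gamma + 2 by lra.
by rewrite /Qpoly !jacobi_horner// !qjacobiS// !hornerM !hornerX.
Qed.

Lemma qjacobi_at0 (a b : R) n : (qjacobi a b n).[0] = 0.
Proof.
by rewrite horner_coef0 coef_qjacobi /qjacobi_coef mul0r mul0r oppr0 mulr0.
Qed.

(** The two lines are treated at once: e = -1 on x = 1 and e = 1 on y = 1, so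
    that (1 + e) / 2 tells whether 1 - x is the variable w or 0. *)
Lemma line_restriction x y : -1 < alpha -> -1 < gamma -> (1 - x) * (1 - y) = 0 ->
  exists w e : R, [/\ e * e = 1, 1 - x = 2^-1 * (1 + e) * w,
    forall n, Ppoly alpha gamma n x y = (wjacobi gamma alpha n).[w]
    & forall n, (0 < n)%N ->
        Qpoly alpha gamma n x y = e * (qjacobi gamma alpha n).[w]].
Proof.
move=> al ga /eqP; rewrite mulf_eq0 => /orP[] /eqP h0.
  exists (1 - y), (-1); split.
  - by rewrite mulrNN mulr1.
  - by rewrite h0 subrr mulr0 mul0r.
  - by move=> n; rewrite PpolyE// h0 addrAC subrr add0r.
  - by move=> n n0; rewrite QpolyE// h0 qjacobi_at0 sub0r mulN1r.
exists (1 - x), 1; split.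
- by rewrite mulr1.
- by field.
- by move=> n; rewrite PpolyE// h0 addrK.
- by move=> n n0; rewrite QpolyE// h0 qjacobi_at0 subr0 mul1r.
Qed.

End lines.

Theorem propositionA2 (R : realType) (alpha gamma x y : R)
    (halpha : -1 < alpha) (hgamma : -1 < gamma)
    (hxy : (1 - x) * (1 - y) = 0) :
  let P n := Ppoly alpha gamma n x y in
  let Q n := Qpoly alpha gamma n x y in
  [/\ (1 - x) * P 0%N =
        1 / 2 * Q 1%N
        - 1 / (2 * (2 + gamma + alpha)) * P 1%N
        + (1 + gamma) / (2 * (2 + gamma + alpha)) * P 0%N,
      (1 - x) * P 1%N =
        (gamma + alpha + 2) / (2 * (4 + gamma + alpha)) * Q 2%N
        - (gamma + alpha + 2)
            / ((3 + gamma + alpha) * (4 + gamma + alpha)) * P 2%N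
        - (1 + alpha) / (4 + gamma + alpha) * Q 1%N
        + (4 + 3 * alpha + gamma * (3 + gamma + alpha))
            / (2 * (2 + gamma + alpha) * (4 + gamma + alpha)) * P 1%N
        - (1 + gamma) * (1 + alpha)
            / (2 * (2 + gamma + alpha) * (3 + gamma + alpha)) * P 0%N,
      (1 - x) * Q 1%N =
        - (1 / (2 * (4 + gamma + alpha))) * Q 2%N
        + 1 / ((3 + gamma + alpha) * (4 + gamma + alpha)) * P 2%N
        + (3 + gamma) / (2 * (4 + gamma + alpha)) * Q 1%N
        - (2 + gamma) / ((2 + gamma + alpha) * (4 + gamma + alpha)) * P 1%N
        + (1 + gamma) * (2 + gamma)
            / (2 * (2 + gamma + alpha) * (3 + gamma + alpha)) * P 0%N
    & forall n : nat, (2 <= n)%N ->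
      let N : R := n%:R in
      (1 - x) * P n =
        (1 + gamma + alpha + N) * (N + gamma + alpha + 2)
          / (2 * (1 + gamma + alpha + 2 * N) * (2 + gamma + alpha + 2 * N))
          * Q n.+1
        - (1 + gamma + alpha + N) * (N + 1)
          / (2 * (1 + gamma + alpha + 2 * N) * (2 + gamma + alpha + 2 * N))
          * P n.+1
        - (alpha + N) * (1 + gamma + alpha + N) * (1 + gamma + alpha + 2 * N)
          / ((1 + gamma + alpha + 2 * N) * (2 + gamma + alpha + 2 * N)
             * (gamma + alpha + 2 * N))
          * Q n
        + ((1 + gamma) * (gamma + alpha) + 2 * (1 + gamma + alpha) * N
           + 2 * N ^+ 2)
          / (2 * (2 + gamma + alpha + 2 * N) * (gamma + alpha + 2 * N))
          * P n
        + (N + alpha) * (N + alpha - 1)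
          / (2 * (1 + gamma + alpha + 2 * N) * (2 * N + gamma + alpha))
          * Q n.-1
        - (N + alpha) * (N + gamma)
          / (2 * (1 + gamma + alpha + 2 * N) * (2 * N + gamma + alpha))
          * P n.-1
      /\
      (1 - x) * Q n =
        - (N * (2 + gamma + alpha + N)
           / (2 * (2 + gamma + alpha + 2 * N) * (2 * N + gamma + alpha + 1)))
          * Q n.+1
        + N * (1 + N)
          / (2 * (2 + gamma + alpha + 2 * N) * (2 * N + gamma + alpha + 1))
          * P n.+1
        + ((1 + gamma) * (2 + gamma + alpha) + 2 * (1 + gamma + alpha) * N
           + 2 * N ^+ 2)
          / (2 * (gamma + alpha + 2 * N) * (2 + gamma + alpha + 2 * N))
          * Q n
        - N * (1 + gamma + N)
          / ((gamma + alpha + 2 * N) * (2 + gamma + alpha + 2 * N))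
          * P n
        - (1 + gamma + N) * (alpha + N - 1)
          / (2 * (gamma + alpha + 2 * N) * (2 * N + gamma + alpha + 1))
          * Q n.-1
        + (1 + gamma + N) * (gamma + N)
          / (2 * (gamma + alpha + 2 * N) * (2 * N + gamma + alpha + 1))
          * P n.-1].
Proof.
have [w [e [ee xw PE QE]]] := @line_restriction _ _ _ _ _ halpha hgamma hxy.
move=> P Q.
pose p n := (wjacobi gamma alpha n).[w].
pose q n := (qjacobi gamma alpha n).[w].
have hP n : (1 - x) * P n = 2^-1 * (w * p n + e * (w * p n)).
  by rewrite /P PE xw /p; ring.
have hQ n : (0 < n)%N -> (1 - x) * Q n = 2^-1 * (w * q n + e * (w * q n)).
  move=> n0; rewrite /Q QE// xw -/(q n).
  transitivity (2^-1 * (e * w * q n + (e * e) * w * q n)); first ring.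
  rewrite ee; ring.
have at_w (u v : {poly R}) : u = v -> u.[w] = v.[w] by move=> ->.
have P0 n : P n = p n by rewrite /P PE.
have Q0 n : (0 < n)%N -> Q n = e * q n by move=> n0; rewrite /Q QE.
have nge n : 0 <= n%:R :> R by exact: ler0n.
split.
(* For n = 0 the polynomials are explicit; the denominators of the
   general relations can vanish. *)
- rewrite hP Q0// !P0 /p /q qjacobiS// !wjacobi0 wjacobi1// mulr1.
  rewrite -polyC1 !(hornerD, hornerN, hornerZ, hornerM, hornerX, hornerC).
  by field; apply/eqP; lra.
- have [/at_w + /at_w + /at_w + /at_w] :=
    jacobi_relations hgamma halpha (ltn0Sn 0).
  rewrite !(hornerD, hornerN, hornerZ, hornerM, hornerX).
  move=> E1 E2 E3 E4.
  rewrite hP {1}E1 E2 !Q0// !P0 /p /q qjacobi0 horner0.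
  by field; repeat (apply/andP; split); apply/eqP; lra.
- have [/at_w + /at_w + /at_w + /at_w] :=
    jacobi_relations hgamma halpha (ltn0Sn 0).
  rewrite !(hornerD, hornerN, hornerZ, hornerM, hornerX).
  move=> E1 E2 E3 E4.
  rewrite hQ// {1}E3 E4 !Q0// !P0 /p /q qjacobi0 horner0.
  by field; repeat (apply/andP; split); apply/eqP; lra.
- move=> n n2 N; rewrite {}/N.
  have n0 : (0 < n)%N by exact: ltnW.
  have n10 : (0 < n.-1)%N by case: n n2 {n0} => [|[]].
  have nge2 : 2 <= n%:R :> R by rewrite ler_nat.
  have [/at_w + /at_w + /at_w + /at_w] :=
    jacobi_relations hgamma halpha n0.
  rewrite !(hornerD, hornerN, hornerZ, hornerM, hornerX).
  move=> E1 E2 E3 E4.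
  split.
    rewrite hP {1}E1 E2 !Q0// !P0 /p /q.
    by field; repeat (apply/andP; split); apply/eqP; lra.
  rewrite hQ// {1}E3 E4 !Q0// !P0 /p /q.
  by field; repeat (apply/andP; split); apply/eqP; lra.
Qed.
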